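(* Let $\mathcal H$ be a separable Hilbert space and let $\mathcal F=\{f_i\}_{i\in I}$ and $\mathcal G=\{g_i\}_{i\in I}$ be two frames for $\mathcal H$. For $\sigma\subseteq I$ let $T_{\mathcal F\mathcal G}^{\sigma}:\ell^2(I)\to\mathcal H$, $T_{\mathcal F\mathcal G}^{\sigma}(\{c_i\}_{i\in I})=\sum_{i\in\sigma}c_if_i+\sum_{i\in\sigma^c}c_ig_i$, be the synthesis operator of the weaving $\{f_i\}_{i\in\sigma}\cup\{g_i\}_{i\in\sigma^c}$. Then $\mathcal F$ and $\mathcal G$ are woven if and only if $R(T_{\mathcal F\mathcal G}^{\sigma})=\mathcal H$ for every $\sigma\subseteq I$.
   Context: The index set $I$ is finite or countably infinite, and $\sigma^c=I\setminus\sigma$. $R(T)$ denotes the range of an operator $T$. A family $\{f_i\}_{i\in I}$ in $\mathcal H$ is a frame for $\mathcal H$ if there are constants $A,B>0$ with $A\|f\|^2\le\sum_{i\in I}|\langle f,f_i\rangle|^2\le B\|f\|^2$ for all $f\in\mathcal H$. Two frames $\{f_i\}_{i\in I}$ and $\{g_i\}_{i\in I}$ for $\mathcal H$ are woven if for every $\sigma\subseteq I$ the family (weaving) $\{f_i\}_{i\in\sigma}\cup\{g_i\}_{i\in\sigma^c}$ (counted with multiplicity) is a frame for $\mathcal H$. By a known result (Bemrose, Casazza, Gröchenig, Lammers, Lynch, ''Weaving frames'') this is equivalent to the existence of universal frame bounds, i.e. constants $0<A\le B$ that are frame bounds for every weaving simultaneously. The synthesis operators above are well-defined and bounded because every weaving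 of two frames is a Bessel sequence. *)

(* Defs.v *)
From HB Require Import structures.
From mathcomp Require Import all_boot all_order all_algebra finmap.
From mathcomp Require Import all_classical all_reals all_analysis.
From mathcomp.real_closed Require Import complex.

Set Implicit Arguments.
Unset Strict Implicit.
Unset Printing Implicit Defensive.

Import Order.TTheory GRing.Theory Num.Theory.

Local Open Scope classical_set_scope.
Local Open Scope ring_scope.

(* [real_or_complex R theta], for [theta : K -> K], says that the scalar field
   is R with the identity or R[i] with complex conjugation. *)
Inductive real_or_complex (R : realType) :
    forall K : numFieldType, (K -> K) -> Prop :=
| real_scalars : @real_or_complex R R idfun
| complex_scalars : @real_or_complex R R[i] (@conjc R).

Definition separable (T : topologicalType) : Prop :=
  exists D : set T, countable D /\ dense D.

Section UnorderedSums.
Context {K : numFieldType} {V : normedModType K} {I : choiceType}.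

(* Finite subsets of I directed by inclusion: convergence along this filter is
   unconditional summability, and needs no enumeration of I. *)
Definition fset_filter : set_system {fset I} :=
  filter_from [set: {fset I}] (fun A => [set B | A `<=` B]%fset).

Global Instance fset_filter_proper : ProperFilter fset_filter.
Proof.
apply: filter_from_proper; last first.
  by move=> A _; exists A; exact: fsubset_refl.
apply: filter_from_filter; first by exists fset0.
move=> A B _ _; exists (A `|` B)%fset => // C /=.
by rewrite fsubUset => /andP[].
Qed.

Definition partial_sum (S : set I) (x : I -> V) (A : {fset I}) : V :=
  \sum_(i <- A | i \in S) x i.

Definition has_sum (S : set I) (x : I -> V) (s : V) : Prop :=
  partial_sum S x @ fset_filter --> s.

Definition sum_over (S : set I) (x : I -> V) : V :=
  lim (partial_sum S x @ fset_filter).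

End UnorderedSums.

Section Frames.
Context {K : numFieldType} {H : normedModType K} {I : choiceType}.

(* A and B are scalars; in R[i], 0 < A means that A is real and positive.
   The existence of the sum s is the finiteness implied by s <= B |x|^2. *)
Definition frame (dot : H -> H -> K) (f : I -> H) : Prop :=
  exists A B : K, [/\ 0 < A, 0 < B & forall x : H, exists s : K^o,
    has_sum setT (fun i => `|dot x (f i)| ^+ 2 : K^o) s /\
    A * `|x| ^+ 2 <= s <= B * `|x| ^+ 2].

(* patch g sigma f is f on sigma and g off sigma; keeping I as the index set
   counts the vectors with multiplicity. *)
Definition weaving (f g : I -> H) (sigma : set I) : I -> H :=
  patch g sigma f.

Definition woven (dot : H -> H -> K) (f g : I -> H) : Prop :=
  forall sigma : set I, frame dot (weaving f g sigma).

Definition ell2 : set (I -> K) :=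
  [set c | exists s : K^o, has_sum setT (fun i => `|c i| ^+ 2 : K^o) s].

(* Meaningful on ell2 only: [lim] is arbitrary on divergent sums. *)
Definition synthesis (f g : I -> H) (sigma : set I) (c : I -> K) : H :=
  sum_over sigma (fun i => c i *: f i) + sum_over (~` sigma) (fun i => c i *: g i).

End Frames.

(* Main.v *)
Require Import Defs.
From mathcomp Require Import all_boot all_order all_algebra.
From mathcomp Require Import finmap.
From mathcomp Require Import all_classical all_reals all_analysis.
From mathcomp.real_closed Require Import complex.
From mathcomp Require Import ring.

Set Implicit Arguments.
Unset Strict Implicit.
Unset Printing Implicit Defensive.

Import Order.TTheory GRing.Theory Num.Theory.
Import numFieldNormedType.Exports.

Local Open Scope classical_set_scope.
Local Open Scope ring_scope.

(** For each sigma the weaving h is a Bessel sequence: its Bessel bound is the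
sum of those of f and g.  Bounded partial sums of |c_i|^2 then make
sum_i c_i h_i converge unconditionally, and [synthesis f g sigma c] is this
single sum over I ([has_sum_synthesis]).  So the theorem reduces to one Bessel
sequence h with synthesis operator T: h is a frame iff T maps ell2 onto H.

One inequality controls T in both directions ([dot_synthesis_le]): for t > 0,
2 |<T c, y>| <= t sum |c_i|^2 + t^-1 sum |<y, h_i>|^2.  It comes from the
arithmetic-geometric mean inequality term by term, passes to the limit, and
replaces the Cauchy-Schwarz inequality in ell2.

A frame has onto synthesis ([frame_synthesis_onto]).  Let S x = sum <x, h_i> h_i
be the frame operator, with bounds A < B.  Then <S x, x> = sum |<x, h_i>|^2 and
|S x|^2 <= B <S x, x>, whence |x - S x / B|^2 <= (1 - A / B) |x|^2.  So
x |-> x - (S x - y) / B is a contraction; its fixed point x has S x = y, and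
the coefficients <x, h_i> are a preimage of y.

Onto synthesis makes a frame ([synthesis_onto_frame]).  Let Y be the set of y
with sum |<y, h_i>|^2 <= 1.  Every z is some T c, so |<z, y>| is bounded over
y in Y.  The uniform boundedness principle ([uniform_boundedness]) bounds Y, say
by C, and by homogeneity this is a lower frame bound (2 C)^-2.

The scalars form a partially ordered field.  The cases of R and R[i] are
separated only for conjugation and for least upper bounds ([scalar_sup]), from
which all convergence of scalars is derived. *)

(** * Real and complex scalars *)

Section Scalars.
Context (R : realType) (K : numFieldType) (theta : K -> K)
  (hK : real_or_complex R theta).

Lemma norm_conj (k : K) : `|theta k| = `|k|.
Proof.
case: hK k => //= -[a b]; rewrite !normc_def /=; congr (_%:C)%C.
by rewrite sqrrN.
Qed.

Lemma mul_conj (k : K) : k * theta k = `|k| ^+ 2.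
Proof.
case: hK k => [k|k]; first by rewrite real_normK ?num_real.
rewrite -add_Re2_Im2; case: k => a b /=; simpc.
by rewrite -!expr2 [b * a]mulrC addNr.
Qed.

Lemma conj_ge0 (k : K) : 0 <= k -> theta k = k.
Proof.
case: hK k => //= -[a b]; rewrite lecE /= => /andP[/eqP -> _].
by rewrite oppr0.
Qed.

(** In R[i] an element of E or an upper bound of E is real, so the supremum is
that of the real parts. *)
Lemma scalar_sup (E : set K) (M : K) : E !=set0 ->
    (forall e, E e -> 0 <= e <= M) ->
  exists s, (forall e, E e -> e <= s) /\
            (forall u, (forall e, E e -> e <= u) -> s <= u).
Proof.
case: hK E M => [|] E M E0 EM.
- have hE : @has_sup _ R E by split=> //; exists M => e /EM /andP[].
  exists (@sup R E); split=> [e|u]; first exact: ub_le_sup hE.2 e.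
  exact: ge_sup.
- pose F : set R := [set complex.Re e | e in E].
  have real_E e : E e -> e = (complex.Re e)%:C%C.
    by move=> /EM /andP[/ger0_real /RRe_real ->].
  have hF : @has_sup _ R F.
    split; first by case: E0 => e Ee; exists (complex.Re e); exists e.
    exists (complex.Re M) => _ [e /EM /andP[_ +] <-].
    by rewrite lecE => /andP[].
  exists (sup F)%:C%C; split=> [e Ee|u Eu].
    by rewrite (real_E e Ee) lecR; apply: (@ub_le_sup R F hF.2); exists e.
  have -> : u = (complex.Re u)%:C%C.
    case: E0 => e Ee; apply/esym/RRe_real/ger0_real/(le_trans _ (Eu e Ee)).
    by case/andP: (EM e Ee).
  rewrite lecR; apply: ge_sup; first exact: hF.1.
  by move=> _ [e /Eu + <-]; rewrite lecE => /andP[].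
Qed.

(** Otherwise the natural numbers would have a least upper bound s, and s - 1
would be another one. *)
Lemma scalar_archi (k : K) : 0 <= k -> exists n : nat, k < n%:R.
Proof.
move=> k0; apply: contrapT => kn.
have nk n : n%:R <= k.
  rewrite real_leNgt ?realn ?ger0_real //; apply/negP => kn'.
  by apply: kn; exists n.
have [||s [s1 s2]] := @scalar_sup [set n%:R | n in [set: nat]] k.
- by exists 0%:R; exists 0%N.
- by move=> _ [n _ <-]; rewrite ler0n nk.
have : s <= s - 1.
  by apply: s2 => _ [n _ <-]; rewrite lerBrDr natr1; apply: s1; exists n.+1.
by rewrite lerDl oppr_ge0 ler10.
Qed.

End Scalars.

(** * Unconditional sums *)

Section FiniteSums.
Context (I : choiceType).

Lemma partial_sumT (K : numFieldType) (V : normedModType K) (x : I -> V)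
  (A : {fset I}) : partial_sum setT x A = \sum_(i <- A) x i.
Proof. by apply: eq_bigl => i; rewrite in_setT. Qed.

Lemma sum_fsetD (V : zmodType) (x : I -> V) (A B : {fset I}) :
  (A `<=` B)%fset -> \sum_(i <- B) x i = \sum_(i <- A) x i + \sum_(i <- (B `\` A)%fset) x i.
Proof.
move=> AB; rewrite -big_cat /=; apply: perm_big; apply: uniq_perm => //.
  rewrite cat_uniq !fset_uniq andbT /=; apply/hasPn => i.
  by rewrite in_fsetD => /andP[].
move=> i; rewrite mem_cat in_fsetD; case: (boolP (i \in A)) => //=.
by move/(fsubsetP AB).
Qed.

End FiniteSums.

Section Summability.
Context (R : realType) (K : numFieldType) (theta : K -> K)
  (hK : real_or_complex R theta) (I : choiceType).

Lemma ler_sum_fset (x : I -> K) (A B : {fset I}) : (forall i, 0 <= x i) ->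
  (A `<=` B)%fset -> \sum_(i <- A) x i <= \sum_(i <- B) x i.
Proof. by move=> x0 AB; rewrite (sum_fsetD _ AB) lerDl sumr_ge0. Qed.

Lemma sup_approx (E : set K) (s e : K) :
  E !=set0 -> (forall k, E k -> 0 <= k) -> (forall k, E k -> k <= s) ->
  (forall u, (forall k, E k -> k <= u) -> s <= u) ->
  0 < e -> exists2 k, E k & s - k < e.
Proof.
move=> [k0 Ek0] E0 Es sE e0; apply: contrapT => nE.
have s0 : 0 <= s by exact: le_trans (E0 _ Ek0) (Es _ Ek0).
have : s <= s - e.
  apply: sE => k Ek; rewrite lerBrDr -lerBrDl.
  rewrite real_leNgt ?ger0_real ?subr_ge0 ?Es ?(ltW e0) //.
  by apply/negP => ske; apply: nE; exists k.
by rewrite lerDl oppr_ge0 lt_geF.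
Qed.

(** The Cauchy condition for unconditional convergence: near-optimal finite sums
of a leave arbitrarily little outside. *)
Lemma fsums_sup (a : I -> K) (M : K) : (forall i, 0 <= a i) ->
    (forall A : {fset I}, \sum_(i <- A) a i <= M) ->
  exists s, [/\ s <= M, forall A : {fset I}, \sum_(i <- A) a i <= s &
    forall e, 0 < e -> exists A : {fset I}, s - \sum_(i <- A) a i < e].
Proof.
move=> a0 aM; pose E := [set \sum_(i <- A) a i | A in [set: {fset I}]].
have E0 : E !=set0 by exists (\sum_(i <- fset0) a i), fset0.
have Ege0 k : E k -> 0 <= k by move=> [A _ <-]; exact: sumr_ge0.
have [|s [s1 s2]] := @scalar_sup _ _ _ hK E M E0.
  by move=> _ [A _ <-]; rewrite sumr_ge0 //= aM.
exists s; split; first by apply: s2 => _ [A _ <-].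
  by move=> A; apply: s1; exists A.
by move=> e e0; have [_ [A _ <-] sA] := sup_approx E0 Ege0 s1 s2 e0; exists A.
Qed.

Lemma cvg_fsetP (V : normedModType K) (x : {fset I} -> V) (s : V) :
  x @ fset_filter --> s <->
  (forall e : K, 0 < e -> exists A : {fset I}, forall B : {fset I},
     (A `<=` B)%fset -> `|s - x B| < e).
Proof.
split=> [/cvgrPdist_lt h e /h [A _ AB]|h]; first by exists A.
by apply/cvgrPdist_lt => e /h [A AB]; exists A.
Qed.

Lemma has_sum_unique (V : normedModType K) (S : set I) (x : I -> V) (s s' : V) :
  has_sum S x s -> has_sum S x s' -> s = s'.
Proof.
exact: (@cvg_unique V (@norm_hausdorff _ _) (partial_sum S x @ fset_filter)).
Qed.

Lemma has_sumB (V : normedModType K) (x x' : I -> V) (s s' : V) :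
  has_sum setT x s -> has_sum setT x' s' ->
  has_sum setT (fun i => x i - x' i) (s - s').
Proof.
move=> xs xs'; rewrite /has_sum.
have -> : partial_sum setT (fun i => x i - x' i) =
    partial_sum setT x \- partial_sum setT x'.
  by apply/funext => F /=; rewrite !partial_sumT sumrB.
exact: cvgB.
Qed.

Lemma has_sum_norm_le (V : normedModType K) (x : I -> V) (v : V) (C : K) :
  has_sum setT x v -> (forall A : {fset I}, `|\sum_(i <- A) x i| <= C) ->
  `|v| <= C.
Proof.
move=> /cvg_fsetP xv xC; apply/ler_addgt0Pl => e /xv [A].
move=> /(_ A (fsubset_refl _)); rewrite partial_sumT => vA.
rewrite -[v](subrK (\sum_(i <- A) x i)); apply: le_trans (ler_normD _ _) _.
by rewrite lerD // ltW.
Qed.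

Lemma nonneg_summable (a : I -> K) (M : K) : (forall i, 0 <= a i) ->
    (forall A : {fset I}, \sum_(i <- A) a i <= M) ->
  exists s : K^o, has_sum setT (a : I -> K^o) s /\ s <= M.
Proof.
move=> a0 aM; have [s [sM sA se]] := fsums_sup a0 aM.
exists s; split=> //; apply/cvg_fsetP => e /se [A Ae]; exists A => B AB.
rewrite partial_sumT ger0_norm ?subr_ge0 ?sA //.
by apply: le_lt_trans Ae; rewrite lerB // ler_sum_fset.
Qed.

(** Positivity of a scalar includes being real.  By the reverse triangle
inequality x also converges to |s|, so s = |s|. *)
Lemma limit_ge0 (x : {fset I} -> K^o) (s : K^o) :
  (forall A, 0 <= x A) -> x @ fset_filter --> s -> 0 <= s.
Proof.
move=> x0 xs; suff -> : s = `|s| by [].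
apply: (@cvg_unique K^o (@norm_hausdorff _ _) (x @ fset_filter)) => //.
apply/cvg_fsetP => e e0; have /cvg_fsetP /(_ e e0) [A AB] := xs.
exists A => B /AB; apply: le_lt_trans.
by rewrite -{1}(ger0_norm (x0 B)) ler_dist_dist.
Qed.

(** Both sides are nonnegative, hence comparable; a partial sum exceeding s by e
keeps all larger ones at distance at least e from s. *)
Lemma partial_sum_le (a : I -> K) (s : K^o) (A : {fset I}) :
  (forall i, 0 <= a i) -> has_sum setT (a : I -> K^o) s ->
  \sum_(i <- A) a i <= s.
Proof.
move=> a0 as_; have s0 : 0 <= s.
  by apply: limit_ge0 as_ => B; rewrite partial_sumT sumr_ge0.
rewrite real_leNgt ?ger0_real ?sumr_ge0 //; apply/negP => sA.
move: sA; rewrite -subr_gt0 => e0; have /cvg_fsetP /(_ _ e0) [B BC] := as_.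
have := BC (A `|` B)%fset (fsubsetUr _ _); rewrite partial_sumT distrC => sAB.
have AB : \sum_(i <- A) a i - s <= \sum_(i <- (A `|` B)%fset) a i - s.
  by rewrite lerB // ler_sum_fset // fsubsetUl.
have AB0 := le_trans (ltW e0) AB.
by have := le_lt_trans AB (le_lt_trans (real_ler_norm (ger0_real AB0)) sAB);
  rewrite ltxx.
Qed.

(** Applied to finite sets B `\` A with A nearly optimal for a, the estimate on
squared norms makes the partial sums Cauchy.  The factor D and the square match
the bound |sum c_i h_i|^2 <= B sum |c_i|^2 of a Bessel sequence. *)
Lemma dominated_summable (V : completeNormedModType K) (x : I -> V) (a : I -> K)
    (D M : K) (S : set I) : (forall i, 0 <= a i) -> 0 < D ->
    (forall A : {fset I}, \sum_(i <- A) a i <= M) ->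
    (forall A : {fset I}, `|\sum_(i <- A | i \in S) x i| ^+ 2
                          <= D * \sum_(i <- A) a i) ->
  exists s, has_sum S x s.
Proof.
move=> a0 D0 aM xa; have [s [_ sA se]] := fsums_sup a0 aM.
suff : cvg (partial_sum S x @ fset_filter).
  by exists (lim (partial_sum S x @ fset_filter)).
apply: cauchy_cvg; apply: cauchy_exP => e e0.
have [A Ae] := se (e ^+ 2 / D) (divr_gt0 (exprn_gt0 2 e0) D0).
exists (partial_sum S x A); exists A => // B AB.
rewrite -ball_normE /= distrC.
have -> : partial_sum S x B - partial_sum S x A =
    \sum_(i <- (B `\` A)%fset | i \in S) x i.
  rewrite /partial_sum !(big_mkcond (fun i => i \in S)) /=.
  by rewrite (sum_fsetD _ AB) addrC addrA addNr add0r.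
rewrite -ltr_sqr ?nnegrE // ?(ltW e0) //; apply: le_lt_trans (xa _) _.
rewrite mulrC -ltr_pdivlMr //; apply: le_lt_trans Ae.
by rewrite lerBrDl -(sum_fsetD _ AB).
Qed.

End Summability.

(** * Absolutely convergent increments and contractions *)

Section Sequences.
Context (R : realType) (K : numFieldType) (theta : K -> K)
  (hK : real_or_complex R theta) (V : completeNormedModType K).

(** The sums of d are bounded and increasing, so they have a supremum and are
Cauchy; |z n - z m| is at most the difference of two of them. *)
Lemma summable_increments (z : nat -> V) (d : nat -> K) (M : K) :
    (forall n, `|z n.+1 - z n| <= d n) ->
    (forall n, \sum_(k < n) d k <= M) ->
  exists l, z @ \oo --> l /\ forall n, `|l - z n| <= M - \sum_(k < n) d k.
Proof.
move=> zd dM; pose a n := \sum_(k < n) d k.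
have d0 n : 0 <= d n by exact: le_trans (zd n).
have a_mono m n : (m <= n)%N -> a m <= a n.
  move=> /subnK <-; elim: (n - m)%N => [|k IH] //.
  by rewrite addSn /a big_ord_recr /= (le_trans IH) // lerDl.
have za m n : (m <= n)%N -> `|z n - z m| <= a n - a m.
  move=> /subnK <-; elim: (n - m)%N => [|k IH].
    by rewrite add0n !subrr normr0.
  rewrite addSn [a _.+1]big_ord_recr /= addrAC.
  apply: le_trans (ler_distD (z (k + m)%N) _ _) _.
  by rewrite addrC lerD.
have [||s [s1 s2]] := @scalar_sup _ _ _ hK [set a n | n in [set: nat]] M.
- by exists (a 0%N), 0%N.
- by move=> _ [n _ <-]; rewrite sumr_ge0 //= dM.
have zl : z @ \oo --> lim (z @ \oo).
  apply: cauchy_cvg; apply: cauchy_exP => e e0.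
  have [||_ [m _ <-] sm] := sup_approx (E := [set a n | n in [set: nat]])
    (s := s) (e := e) _ _ s1 s2 e0.
  - by exists (a 0%N), 0%N.
  - by move=> _ [n _ <-]; exact: sumr_ge0.
  exists (z m); exists m => // n /= mn; rewrite -ball_normE /= distrC.
  apply: le_lt_trans (za _ _ mn) (le_lt_trans _ sm).
  by rewrite lerB // s1 //; exists n.
exists (lim (z @ \oo)); split=> // n; apply/ler_addgt0Pl => e e0.
have /cvgrPdist_lt /(_ e e0) [m _ mz] := zl.
apply: le_trans (ler_distD (z (maxn m n)) _ _) _; apply: lerD.
  by rewrite ltW // mz //= leq_maxl.
apply: le_trans (za _ _ (leq_maxr _ _)) _.
by rewrite lerB // dM.
Qed.

Lemma geometric_sum_le (q : K) n : 0 <= q < 1 ->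
  \sum_(k < n) q ^+ k <= (1 - q)^-1.
Proof.
case/andP=> q0 q1; have q1' : 0 < 1 - q by rewrite subr_gt0.
rewrite -[leRHS]mul1r ler_pdivlMr // mulrC -opprB mulNr -subrX1 opprB.
by rewrite gerDl oppr_le0 exprn_ge0.
Qed.

(** Banach's theorem for real or complex scalars, by iteration from 0. *)
Lemma contraction_fixpoint (G : V -> V) (q : K) : 0 <= q < 1 ->
  (forall x y, `|G x - G y| <= q * `|x - y|) -> exists x, G x = x.
Proof.
move=> q01 Gq; have /andP[q0 q1] := q01; pose z n := iter n G 0.
have zd n : `|z n.+1 - z n| <= q ^+ n * `|z 1%N - z 0%N|.
  elim: n => [|n IH]; first by rewrite mul1r.
  by rewrite (le_trans (Gq _ _)) // exprS -mulrA ler_wpM2l.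
have [|x [zx _]] := @summable_increments z _
  ((1 - q)^-1 * `|z 1%N - z 0%N|) zd.
  by move=> n; rewrite -mulr_suml ler_wpM2r // geometric_sum_le.
exists x; apply/eqP; rewrite -subr_eq0 -normr_le0.
apply/ler_addgt0Pl => e e0; rewrite addr0.
have e2 : 0 < e / 2 by rewrite divr_gt0.
have /cvgrPdist_lt /(_ _ e2) [n _ nz] := zx.
rewrite (splitr e); apply: le_trans (ler_distD (z n.+1) _ _) _.
apply: lerD; last by rewrite distrC ltW // nz /=.
apply: le_trans (Gq _ _) _.
by rewrite (le_trans (ler_piMl _ (ltW q1))) // ltW // nz /=.
Qed.

End Sequences.

(** * Inner product spaces *)

Section Hilbert.
Context (R : realType) (K : numFieldType) (theta : K -> K)
  (hK : real_or_complex R theta) (H : completeNormedModType K)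
  (dot : {dot H for theta}) (norm_dot : forall x : H, `|x| ^+ 2 = dot x x).

Lemma dotC (x y : H) : dot x y = theta (dot y x).
Proof. by rewrite (@hermitian_subproof _ _ false theta dot) expr0 mul1r. Qed.

Lemma norm_dotC (x y : H) : `|dot x y| = `|dot y x|.
Proof. by rewrite dotC (norm_conj hK). Qed.

(** The orthogonal projection v of x on y satisfies |v| <= |x| by Pythagoras,
and |v| = |<x, y>| / |y|. *)
Lemma cauchy_schwarz (x y : H) : `|dot x y| <= `|x| * `|y|.
Proof.
have [->|y0] := eqVneq y 0; first by rewrite linear0r !normr0 mulr0.
have yy0 : dot y y != 0 by rewrite -norm_dot expf_neq0 // normr_eq0.
pose v := (dot x y / dot y y) *: y; pose u := x - v.
have uy : dot u y = 0 by rewrite linearBl linearZl_LR /= mulfVK // subrr.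
have uv : dot u v = 0 by rewrite linearZr_LR /= uy mulr0.
have vu : dot v u = 0.
  by rewrite dotC uv; apply/eqP; rewrite -normr_eq0 (norm_conj hK) normr0.
have xE : x = u + v by rewrite subrK.
have vE : v = (dot x y / dot y y) *: y by [].
clearbody u v.
have pythagoras : `|x| ^+ 2 = `|u| ^+ 2 + `|v| ^+ 2.
  by rewrite !norm_dot {1 2}xE linearDl !linearDr /= uv vu addr0 add0r.
have vx : `|v| <= `|x|.
  by rewrite -ler_sqr ?nnegrE // pythagoras lerDr exprn_ge0.
have yn : 0 < `|y| by rewrite normr_gt0.
move: vx; rewrite vE normrZ normf_div -norm_dot normrX normr_id expr2.
by rewrite invfM mulrA mulfVK ?gt_eqF // ler_pdivrMr.
Qed.

(** The Banach-Steinhaus theorem for the functionals <., y>, without Baire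
category.  If Y is unbounded, take y_n in Y with |y_n| > (n+1) 3^n, and walk by
steps z_(n+1) = z_n +- u_n, where u_n is parallel to y_n with |u_n| = 3^-n.  One
of the two signs gives |<z_(n+1), y_n>| >= 3^-n |y_n|.  The limit l is within
3^-n / 2 of z_(n+1), so |<l, y_n>| > (n+1) / 2 for all n. *)
Lemma uniform_boundedness (Y : set H) :
    (forall z : H, exists C : K, forall y, Y y -> `|dot z y| <= C) ->
  exists2 C : K, 0 < C & forall y, Y y -> `|y| <= C.
Proof.
move=> Yz; apply: contrapT => nY.
have unb n : exists y, Y y /\ (n.+1)%:R * 3 ^+ n < `|y|.
  apply: contrapT => nn; apply: nY; exists (n.+1%:R * 3 ^+ n).
    by rewrite mulr_gt0 ?exprn_gt0.
  move=> y Yy; rewrite real_leNgt ?normr_real ?ger0_real ?mulr_ge0 ?exprn_ge0 //.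
  by apply/negP => ny; apply: nn; exists y.
have [y yY] := choice unb.
have y0 n : 0 < `|y n|.
  apply: le_lt_trans (yY n).2; by rewrite mulr_ge0 ?exprn_ge0.
pose r : K := 3^-1.
have r0 : 0 < r by rewrite invr_gt0.
pose u n := (r ^+ n / `|y n|) *: y n.
have un n : `|u n| = r ^+ n.
  rewrite normrZ normf_div normr_id mulfVK ?gt_eqF // ger0_norm // exprn_ge0 //.
  exact: ltW.
have duy n : `|dot (u n) (y n)| = r ^+ n * `|y n|.
  rewrite linearZl_LR /= -norm_dot normrM normf_div !normrX !normr_id.
  by rewrite (gtr0_norm r0) [X in _ * X = _]expr2 mulrA mulfVK ?gt_eqF.
pose step n x := if `|dot (x + u n) (y n)| >= r ^+ n * `|y n|
  then x + u n else x - u n.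
pose z := fix z n := if n is m.+1 then step m (z m) else 0.
have zy n : r ^+ n * `|y n| <= `|dot (z n.+1) (y n)|.
  rewrite /= /step; case: ifPn => //.
  rewrite -real_ltNge ?normr_real ?ger0_real ?mulr_ge0 ?exprn_ge0 ?(ltW r0) //.
  move=> lt.
  (* <z + u, y> - <z - u, y> = 2 <u, y>, so both cannot be small. *)
  rewrite -(lerD2l `|dot (z n + u n) (y n)|) -duy.
  apply: (@le_trans _ _ (`|dot (u n) (y n)| *+ 2)).
    by rewrite mulr2n lerD2r duy ltW.
  rewrite -normrMn.
  have -> : dot (u n) (y n) *+ 2 = dot (z n + u n) (y n) - dot (z n - u n) (y n).
    by rewrite -linearBl opprD opprK addrACA subrr add0r linearDl mulr2n.
  exact: ler_normB.
have zd n : `|z n.+1 - z n| <= r ^+ n.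
  by rewrite /= /step; case: ifP => _; rewrite addrAC subrr add0r ?normrN un.
have r01 : 0 <= r < 1 by rewrite ltW //= invf_lt1 // ltr1n.
have [|l [_ lz]] := @summable_increments _ _ _ hK H z _ (1 - r)^-1 zd.
  by move=> n; exact: geometric_sum_le.
(* The tail of the steps, 3^-(n+1) + 3^-(n+2) + ..., is half of 3^-n. *)
have lzn n : `|l - z n.+1| <= r ^+ n / 2.
  apply: le_trans (lz _) _.
  have r1 : 1 - r != 0 by rewrite subr_eq0 gt_eqF //; case/andP: r01.
  have -> : \sum_(k < n.+1) r ^+ k = (1 - r ^+ n.+1) / (1 - r).
    apply: (mulIf r1); rewrite mulfVK // mulrC -opprB mulNr -subrX1 opprB //.
  rewrite -[X in X - _]mul1r -mulrBl opprB addrC subrK exprSr -mulrA.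
  rewrite ler_wpM2l ?exprn_ge0 ?(ltW r0) //.
  suff -> : r / (1 - r) = 2^-1 by [].
  apply: (mulIf r1); by rewrite mulfVK // /r; field.
have [C lC] := Yz l.
have C0 : 0 <= C by apply: le_trans (lC _ (yY 0%N).1).
have [n Cn] := scalar_archi hK (mulr_ge0 C0 (ler0n _ 2)).
have : n.+1%:R <= C * 2.
  rewrite -ler_pdivrMr //; apply: le_trans (lC _ (yY n).1).
  have : r ^+ n * `|y n| / 2 <= `|dot l (y n)|.
    rewrite -(lerD2r (r ^+ n * `|y n| / 2)) -splitr.
    apply: le_trans (zy n) _.
    rewrite -[z n.+1](subrK l) linearDl addrC.
    apply: le_trans (ler_normD _ _) _; rewrite lerD2l /=.
    apply: le_trans (cauchy_schwarz _ _) _; rewrite distrC mulrAC.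
    by apply: ler_wpM2r => //; exact: lzn.
  apply: le_trans; rewrite ler_pM2r ?invr_gt0 //.
  rewrite mulrC -ler_pdivrMr ?exprn_gt0 // /r exprVn invrK.
  exact: ltW (yY n).2.
by move=> /le_lt_trans /(_ Cn); rewrite ltr_nat ltnNge leqnSn.
Qed.

(** * Bessel sequences and frames *)

Section Bessel.
Context (I : choiceType).
Implicit Types (h : I -> H) (c : I -> K).

(** Term by term, 2 |c_i| |<y, h_i>| <= t |c_i|^2 + t^-1 |<y, h_i>|^2. *)
Lemma dot_sum_le h c (P : pred I) (A : {fset I}) (y : H) (t : K) : 0 < t ->
  `|dot (\sum_(i <- A | P i) c i *: h i) y| *+ 2 <=
  t * (\sum_(i <- A) `|c i| ^+ 2) + t^-1 * (\sum_(i <- A) `|dot y (h i)| ^+ 2).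
Proof.
move=> t0; rewrite linear_sumlz !mulr_sumr -big_split /=.
apply: (@le_trans _ _ (\sum_(i <- A | P i) `|c i| * `|dot y (h i)| *+ 2)).
  rewrite sumrMnl lerMn2r /=; apply: le_trans (ler_norm_sum _ _ _) _.
  by apply: ler_sum => i _; rewrite linearZl_LR /= normrM [X in _ * X]norm_dotC.
rewrite big_mkcond; apply: ler_sum => i _; set a := `|c i|; set b := `|dot y _|.
have tt : 0 <= t by exact: ltW.
have ab : a * b *+ 2 <= t * a ^+ 2 + t^-1 * b ^+ 2.
  rewrite -(ler_pM2l t0) [leRHS]mulrDr [t * (t^-1 * _)]mulrA divff ?gt_eqF // mul1r.
  have [ab _] := @real_leif_mean_square_scaled _ (t * a) b
    (ger0_real (mulr_ge0 tt (normr_ge0 _))) (normr_real _).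
  by rewrite mulrnAr mulrA [t * (t * _)]mulrA -[t * t]expr2 -exprMn.
case: (P i) => //.
by rewrite addr_ge0 ?mulr_ge0 ?invr_ge0 ?exprn_ge0 ?normr_ge0.
Qed.

Definition bessel h (B : K) := forall (x : H) (A : {fset I}),
  \sum_(i <- A) `|dot x (h i)| ^+ 2 <= B * `|x| ^+ 2.

(** Take y = v, the sum itself, and t = B: the last term of [dot_sum_le] is at
most |v|^2, half of the left-hand side. *)
Lemma bessel_synthesis_le h B c (P : pred I) (A : {fset I}) : 0 < B ->
  bessel h B ->
  `|\sum_(i <- A | P i) c i *: h i| ^+ 2 <= B * \sum_(i <- A) `|c i| ^+ 2.
Proof.
move=> B0 hB; set v := \sum_(i <- A | P i) _.
have := dot_sum_le h c P A v B0; rewrite -/v -norm_dot normrX normr_id mulr2n.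
have Bh : B^-1 * (\sum_(i <- A) `|dot v (h i)| ^+ 2) <= `|v| ^+ 2.
  by rewrite mulrC ler_pdivrMr // mulrC hB.
by move=> /le_trans /(_ (lerD (lexx _) Bh)); rewrite lerD2r.
Qed.

Lemma ell2P c : ell2 c <->
  exists M : K, forall A : {fset I}, \sum_(i <- A) `|c i| ^+ 2 <= M.
Proof.
split=> [[s cs]|[M cM]].
  exists s => A; apply: (partial_sum_le A _ cs) => i; exact: exprn_ge0.
have [|s [cs _]] := nonneg_summable hK _ cM; first by move=> i; exact: exprn_ge0.
by exists s.
Qed.

Lemma bessel_summable h B c (S : set I) : 0 < B -> bessel h B -> ell2 c ->
  has_sum S (fun i => c i *: h i) (sum_over S (fun i => c i *: h i)).
Proof.
move=> B0 hB /ell2P[M cM].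
have [||s cs] := @dominated_summable _ _ _ hK I H
  (fun i => c i *: h i) (fun i => `|c i| ^+ 2) B M S _ B0 cM.
- by move=> i; exact: exprn_ge0.
- by move=> A; exact: bessel_synthesis_le.
by rewrite /sum_over (cvg_lim (@norm_hausdorff _ _) cs).
Qed.

Lemma has_sum_dot (x : I -> H) (v y : H) : has_sum setT x v ->
  has_sum setT (fun i => dot (x i) y : K^o) (dot v y : K^o).
Proof.
move=> /cvg_fsetP xv; apply/cvg_fsetP => e e0.
have y0 : 0 < `|y| + 1 by rewrite ltr_wpDl.
have [A Ae] := xv _ (divr_gt0 e0 y0); exists A => B /Ae.
rewrite !partial_sumT -linear_sumlz -linearBl ltr_pdivlMr // => vB.
apply: le_lt_trans (cauchy_schwarz _ _) (le_lt_trans _ vB).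
by rewrite ler_wpM2l // lerDl.
Qed.

Lemma dot_synthesis_le h c (v y : H) (s M t : K) : 0 < t ->
    has_sum setT (fun i => c i *: h i) v ->
    (forall A : {fset I}, \sum_(i <- A) `|c i| ^+ 2 <= s) ->
    (forall A : {fset I}, \sum_(i <- A) `|dot y (h i)| ^+ 2 <= M) ->
  `|dot v y| *+ 2 <= t * s + t^-1 * M.
Proof.
move=> t0 /has_sum_dot hv cs yM; rewrite -mulr_natr -ler_pdivlMr ?ltr0n //.
apply: has_sum_norm_le (hv y) _ => A.
rewrite -linear_sumlz ler_pdivlMr ?ltr0n // mulr_natr.
apply: le_trans (dot_sum_le h c xpredT A y t0) _.
by rewrite lerD // ler_pM2l ?invr_gt0.
Qed.

(** A Bessel bound on finite sums supplies both the convergence of the frame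
sums and the upper frame bound. *)
Lemma frameP h : frame dot h <-> exists A B : K, [/\ 0 < A, 0 < B, bessel h B &
  forall x : H, exists s : K^o,
    has_sum setT (fun i => `|dot x (h i)| ^+ 2 : K^o) s /\ A * `|x| ^+ 2 <= s].
Proof.
have sq0 x i : 0 <= `|dot x (h i)| ^+ 2 by exact: exprn_ge0.
split=> [[A [B [A0 B0 AB]]]|[A [B [A0 B0 hB hA]]]]; exists A, B; split=> //.
- move=> x F; have [s [xs /andP[_ sB]]] := AB x.
  exact: le_trans (partial_sum_le F (sq0 x) xs) sB.
- by move=> x; have [s [xs /andP[sA _]]] := AB x; exists s.
- move=> x; have [s [xs sA]] := hA x; exists s; split=> //; rewrite sA /=.
  have [s' [xs' s'B]] := nonneg_summable hK (sq0 x) (hB x).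
  by rewrite (has_sum_unique xs xs').
Qed.


(** The frame operator S is inverted by iterating x |-> x - (S x - y) / B. *)
Lemma frame_synthesis_onto h (y : H) : frame dot h ->
  exists2 c : I -> K, ell2 c & has_sum setT (fun i => c i *: h i) y.
Proof.
move=> /frameP[A [B0 [A0 B00 hB0 hA]]].
(* The bound is enlarged so that A / B < 1, even when H = 0. *)
pose B := A + B0; have B_gt0 : 0 < B by exact: addr_gt0.
have hB : bessel h B.
  by move=> x F; apply: le_trans (hB0 x F) _; rewrite ler_wpM2r // lerDr ltW.
pose coef x := fun i => dot x (h i).
pose S x := sum_over setT (fun i => coef x i *: h i).
have coef2 x : ell2 (coef x) by apply/ell2P; exists (B * `|x| ^+ 2); exact: hB.
have hS x : has_sum setT (fun i => coef x i *: h i) (S x).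
  exact: bessel_summable B_gt0 hB (coef2 x).
have SB x x' : S (x - x') = S x - S x'.
  apply: has_sum_unique (hS _) _; have := has_sumB (hS x) (hS x').
  congr (has_sum _ _ _); apply/funext => i.
  by rewrite -scalerBl /coef linearBl.
pose t := B^-1; have t0 : 0 < t by rewrite invr_gt0.
(* Chosen so that 1 - A / B <= q ^+ 2, which spares a square root. *)
pose q := 1 - A / B / 2.
have a01 : 0 < A / B < 1.
  by rewrite divr_gt0 //= ltr_pdivrMr // mul1r ltrDl.
have /andP[a0 a1] := a01.
have q01 : 0 <= q < 1.
  rewrite subr_ge0 ltrBlDr ltrDl divr_gt0 // andbT ler_pdivrMr // mul1r.
  by apply: ltW (lt_trans a1 _); rewrite ltr1n.
have contract x : `|x - t *: S x| <= q * `|x|.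
  have [s [xs sA]] := hA x.
  have sF F := partial_sum_le F (fun i => exprn_ge0 2 (normr_ge0 _)) xs.
  have s0 : 0 <= s by apply: le_trans sA; rewrite mulr_ge0 ?(ltW A0) ?exprn_ge0.
  have Sx : dot (S x) x = s.
    apply: (has_sum_unique (V := K^o) (has_sum_dot (y := x) (hS x))).
    move: xs; congr (has_sum _ _ _); apply/funext => i.
    by rewrite linearZl_LR /= [dot (h i) x]dotC (mul_conj hK).
  have xS : dot x (S x) = s by rewrite dotC Sx (conj_ge0 hK).
  (* |S x|^2 <= B <S x, x>, from [dot_synthesis_le] with y := S x and
     parameter B; the term in |S x|^2 absorbs half of the left-hand side. *)
  have SS : t * `|S x| ^+ 2 <= s.
    have := dot_synthesis_le B_gt0 (hS x) sF (hB (S x)).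
    rewrite -norm_dot normrX normr_id mulrA mulVf ?gt_eqF // mul1r mulr2n lerD2r.
    by move=> SxB; rewrite /t mulrC ler_pdivrMr // mulrC.
  have [q0 q1] := andP q01.
  rewrite -ler_sqr ?nnegrE ?mulr_ge0 // norm_dot linearBl !linearBr /=.
  rewrite !linearZl_LR !linearZr_LR /= Sx xS (conj_ge0 hK (ltW t0)) -!norm_dot.
  rewrite exprMn.
  have -> : `|x| ^+ 2 - t * s - (t * s - t * (t * `|S x| ^+ 2)) =
    `|x| ^+ 2 - t * s - t * (s - t * `|S x| ^+ 2) by rewrite mulrBr.
  apply: (@le_trans _ _ (`|x| ^+ 2 - t * s)).
    by rewrite lerBlDr lerDl mulr_ge0 ?subr_ge0 // ltW.
  apply: (@le_trans _ _ ((1 - A / B) * `|x| ^+ 2)).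
    rewrite mulrBl mul1r lerB // [A / B]mulrC -mulrA ler_pM2l //.
  rewrite ler_wpM2r ?exprn_ge0 // /q sqrrB expr1n mul1r -mulr_natr mulfVK //.
  by rewrite lerDl exprn_ge0 // divr_ge0 // ltW.
have [|x Gx] := @contraction_fixpoint _ _ _ hK H
  (fun x => x - t *: (S x - y)) q q01.
  move=> x x'; apply: le_trans (contract _); rewrite SB.
  have <- : t *: (S x - y) - t *: (S x' - y) = t *: (S x - S x').
    by rewrite -scalerBr opprB addrA subrK.
  by rewrite !opprD !opprK addrACA.
exists (coef x) => //; suff <- : S x = y by exact: hS.
apply/eqP; rewrite -subr_eq0; have /eqP := Gx.
by rewrite -subr_eq0 addrAC subrr add0r oppr_eq0 scaler_eq0 gt_eqF.
Qed.

(** If the sum s of |<x, h_i>|^2 were below (2 C)^-2 |x|^2, then rescaling x to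
norm 2 C would give an element of the set Y, which lies in the ball of radius C. *)
Lemma synthesis_onto_frame h (B : K) : 0 < B -> bessel h B ->
    (forall y, exists2 c : I -> K, ell2 c &
       has_sum setT (fun i => c i *: h i) y) ->
  frame dot h.
Proof.
move=> B0 hB onto; have sq0 x i : 0 <= `|dot x (h i)| ^+ 2 by exact: exprn_ge0.
pose Y := [set y | forall A : {fset I}, \sum_(i <- A) `|dot y (h i)| ^+ 2 <= 1].
have [z|C C0 YC] := @uniform_boundedness Y.
  have [c /ell2P[s cs] cz] := onto z; exists (s + 1) => y Yy.
  have := dot_synthesis_le ltr01 cz cs Yy; rewrite mul1r invr1 mulr1.
  by apply: le_trans; rewrite mulr2n lerDl.
pose a := (C * 2)^-1; have a0 : 0 < a by rewrite invr_gt0 mulr_gt0.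
apply/frameP; exists (a ^+ 2), B; split=> //; first by rewrite exprn_gt0.
move=> x; have [s [xs sB]] := nonneg_summable hK (sq0 x) (hB x).
have sF F := partial_sum_le F (sq0 x) xs.
have s0 : 0 <= s by apply: le_trans (sF fset0); rewrite sumr_ge0.
exists s; split=> //; rewrite -exprMn real_leNgt ?ger0_real //; last first.
  by rewrite exprn_ge0 // mulr_ge0 // ltW.
apply/negP => sx.
have x0 : 0 < `|x|.
  rewrite normr_gt0; apply: contraTneq sx => ->.
  by rewrite normr0 mulr0 expr0n /= le_gtF.
pose k := a * `|x|; have k0 : 0 < k by exact: mulr_gt0.
have /YC : Y (k^-1 *: x).
  move=> F; have -> : \sum_(i <- F) `|dot (k^-1 *: x) (h i)| ^+ 2 =
      k ^- 2 * \sum_(i <- F) `|dot x (h i)| ^+ 2.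
    rewrite mulr_sumr; apply: eq_bigr => i _.
    by rewrite linearZl_LR /= normrM exprMn normfV (gtr0_norm k0) exprVn.
  rewrite mulrC ler_pdivrMr ?exprn_gt0 // mul1r.
  exact: le_trans (sF F) (ltW sx).
rewrite normrZ normfV (gtr0_norm k0) /k invfM mulfVK ?gt_eqF // invrK.
by rewrite ger_pMr // lern1.
Qed.

Lemma bessel_weaving (f g : I -> H) (B C : K) (sigma : set I) :
  bessel f B -> bessel g C -> bessel (weaving f g sigma) (B + C).
Proof.
move=> fB gC x A; rewrite mulrDl; apply: le_trans (lerD (fB x A) (gC x A)).
rewrite -big_split /=; apply: ler_sum => i _; rewrite /weaving /patch.
by case: ifP => _; rewrite ?lerDl ?lerDr exprn_ge0.
Qed.

(** The two sums defining the synthesis are over complementary sets of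
indices, on which the weaving agrees with f and with g. *)
Lemma has_sum_synthesis (f g : I -> H) (B : K) (sigma : set I) c :
    0 < B -> bessel (weaving f g sigma) B -> ell2 c ->
  has_sum setT (fun i => c i *: weaving f g sigma i) (synthesis f g sigma c).
Proof.
move=> B0 hB c2.
have Pf : partial_sum sigma (fun i => c i *: weaving f g sigma i) =
          partial_sum sigma (fun i => c i *: f i).
  apply/funext => A; apply: eq_bigr => i si.
  by rewrite /weaving /patch si.
have Pg : partial_sum (~` sigma) (fun i => c i *: weaving f g sigma i) =
          partial_sum (~` sigma) (fun i => c i *: g i).
  apply/funext => A; apply: eq_bigr => i; rewrite in_setC /weaving /patch.
  by move/negbTE ->.
rewrite /has_sum /synthesis /sum_over -Pf -Pg.
have -> : partial_sum setT (fun i => c i *: weaving f g sigma i) =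
    partial_sum sigma (fun i => c i *: weaving f g sigma i) \+
    partial_sum (~` sigma) (fun i => c i *: weaving f g sigma i).
  apply/funext => A; rewrite partial_sumT /= (bigID (mem sigma)) /=.
  by congr (_ + _); apply: eq_bigl => i; rewrite in_setC.
by apply: cvgD; exact: bessel_summable B0 hB c2.
Qed.

End Bessel.
End Hilbert.

Theorem theorem3p10 (R : realType) (K : numFieldType) (theta : K -> K)
    (hK : real_or_complex R theta)
    (H : completeNormedModType K) (dot : {dot H for theta})
    (norm_dot : forall x : H, `|x| ^+ 2 = dot x x)
    (H_sep : separable H)
    (I : countType) (f g : I -> H)
    (f_frame : frame dot f) (g_frame : frame dot g) :
  woven dot f g <->
  forall sigma : set I, synthesis f g sigma @` ell2 = [set: H].
Proof.
have /(frameP hK)[_ [B [_ B0 fB _]]] := f_frame.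
have /(frameP hK)[_ [C [_ C0 gC _]]] := g_frame.
have BC0 : 0 < B + C by exact: addr_gt0.
have hBC sigma := bessel_weaving sigma fB gC.
have syn sigma c := has_sum_synthesis hK norm_dot BC0 (hBC sigma) (c := c).
split=> [fg sigma|onto sigma].
  apply/seteqP; split=> // y _.
  have [c c2 cy] := frame_synthesis_onto hK norm_dot y (fg sigma).
  exists c => //.
  exact: has_sum_unique (syn sigma c c2) cy.
apply: (synthesis_onto_frame hK norm_dot BC0 (hBC sigma)) => y.
have : [set: H] y by [].
rewrite -(onto sigma) => -[c c2 <-].
by exists c => //; exact: syn.
Qed.
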